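(* Let $X$ be a real topological-linear space, $Y$ a real locally convex space, $\Omega\subseteq X$ nonempty, $f:X\to Y$, $\mathbb A:\Omega\to2^Y$ a cone-valued map, and $\psi:Y\to\mathbb R$ a seminorm. Assume that $K\subseteq Y$ is a nontrivial, closed, convex cone with $0\notin\operatorname{cl}S_{-K}(\psi)$, $\bar x\in\mathrm{PEff}_{\mathbb A}(\Omega\mid f,K)$, and $A:=\mathbb A(\bar x)$ is a cone in $Y$ with $\{0\}\ne f[\Omega]-f(\bar x)\subseteq A$. Suppose that $B_K(\psi)$ and $B_A(\psi)$ are normlike-bases for $K$ and $A$, and that one of the sets $\operatorname{cl}S_{-K}(\psi)$ and $\operatorname{cl}S^0_A(\psi)$ is compact. Moreover, assume that one of the following statements is valid: (a) $A$ is closed and convex. (b) There is $(y^*,\beta)\in Y^*\times\mathbb P$ such that $\operatorname{cl}S_{-K}(\psi)=\{x\in\operatorname{cl}\mathbb B_\psi\mid y^*(x)\ge\beta\}$, and one of the following conditions holds: $B_A(\psi)$ is compact; or $S^0_A(\psi)$ is closed; or $A$ is closed and $\operatorname{cl}B_A(\psi)$ is compact; or $A$ is closed and $\operatorname{conv}(\operatorname{cl}(B_A(\psi))\cup\{0\})$ is closed. Then there is $(x^*,\alpha)\in K^{a\#}(\psi)\cap(Y^*\times\mathbb P)$ such that, with $C:=C_\psi(x^*,\alpha)$, $\bar x\in\mathrm{Eff}(\Omega\mid f,C)$. Moreover, if $C\neq\ell(C)$ and $\varphi:Y\to\mathbb R$ is a sublinear functional with $\varphi(0)=0$ which is $-C$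 representing, then: (i) for any $k\in C\setminus\ell(C)$, $\{(x,0)\mid x\in\Omega,\ f(x)=f(\bar x)\}$ is the set of solutions of $(P_\varphi^{a,k})$ for $a=f(\bar x)$; (ii) $\{x\in\Omega\mid f(x)=f(\bar x)\}=\operatorname{argmin}_{x\in\Omega}\varphi(f(x)-f(\bar x))$; (iii) if $\mathcal P\subseteq Y$, $\mathcal T\subseteq C\setminus\ell(C)$, $\mathcal R\subseteq\mathbb R$ satisfy $f[\mathrm{Eff}(\Omega\mid f,C)]\subseteq\mathcal P+\mathcal R\cdot\mathcal T$, then there are $a\in\mathcal P$, $k\in\mathcal T$, $s\in\mathcal R$ so that $\{(x,s)\mid x\in\Omega,\ f(x)=f(\bar x)\}$ is the set of solutions of $(P_\varphi^{a,k})$; (iv) if, in addition to the assumption in (iii), $C$ is closed, then there are $a\in\mathcal P$, $k\in\mathcal T$, $s\in\mathcal R$ so that $\varphi^G_{a-C,k}(f(\bar x))=s$ and $\{x\in\Omega\mid f(x)=f(\bar x)\}=\operatorname{argmin}_{x\in\Omega}\varphi^G_{a-C,k}(f(x))$.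
   Context: $Y^*$ is the topological dual of $Y$, $\mathbb R_+=[0,\infty)$, $\mathbb P=(0,\infty)$. A set $K\subseteq Y$ is a cone if $0\in K=\mathbb R_+\cdot K$; it is nontrivial if $\{0\}\ne K\ne Y$; $\ell(K):=K\cap(-K)$. $\mathbb B_\psi:=\{y\in Y\mid\psi(y)\le1\}$. For a cone $M$: $B_M(\psi):=\{x\in M\mid\psi(x)=1\}$, $S_M(\psi):=\operatorname{conv}(B_M(\psi))$, $S^0_M(\psi):=\operatorname{conv}(\{0\}\cup B_M(\psi))$; $B_M(\psi)$ is a normlike-base for $M$ if $M$ is nontrivial and $\psi>0$ on $M\setminus\{0\}$. $K^{a\#}(\psi):=\{(x^*,\alpha)\in Y^*\times\mathbb R_+\mid\forall y\in K\setminus\{0\}:\ x^*(y)-\alpha\psi(y)>0\}$. $C_\psi(x^*,\alpha):=\{y\in Y\mid x^*(y)\ge\alpha\psi(y)\}$. $\varphi$ is $-C$ representing if $-C=\{y\in Y\mid\varphi(y)\le0\}$. $\mathrm{Eff}(\Omega\mid f,C)$ is the set of $\bar x\in\Omega$ for which there is no $x\in\Omega$ with $f(x)\in f(\bar x)-(C\setminus\{0\})$; $\mathrm{PEff}_{\mathbb A}(\Omega\mid f,K)$ is the set of $\bar x\in\mathrm{Eff}(\Omega\mid f,K)$ with $\mathbb A(\bar x)\cap(-K)=\{0\}$. $f[D]$ is the image of $D$. $(P_\varphi^{a,k})$ is the problem: minimize $\lambda$ subject to $\varphi(f(x)-a-\lambda k)\le0$, $(x,\lambda)\in\Omega\times\mathbb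 R$; a solution is a feasible pair with $\lambda$ minimal among all feasible pairs. $\varphi^G_{a-C,k}(y):=\inf\{t\in\mathbb R\mid y\in tk+(a-C)\}\in\mathbb R\cup\{\pm\infty\}$ ($\inf\emptyset=+\infty$). *)

(* Defs.v *)
From HB Require Import structures.
From mathcomp Require Import all_boot all_order all_algebra.
From mathcomp Require Import all_classical all_reals all_analysis.

Set Implicit Arguments.
Unset Strict Implicit.
Unset Printing Implicit Defensive.

Import Order.TTheory GRing.Theory Num.Theory.
Import numFieldNormedType.Exports.

Local Open Scope classical_set_scope.
Local Open Scope ring_scope.

Section LinearSpace.
Context {R : realType} {Y : lmodType R}.
Implicit Types (A B C K M : set Y) (psi phi : Y -> R) (k y : Y).

Definition oppset A : set Y := [set - y | y in A].

Definition addset A B : set Y := [set y + z | y in A & z in B].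

Definition scaleset (T : set R) A : set Y := [set t *: y | t in T & y in A].

Definition is_cone K : Prop := K 0 /\ scaleset [set t | 0 <= t] K = K.

Definition nontrivial K : Prop := [set 0] <> K /\ K <> [set: Y].

Definition linspace K : set Y := K `&` oppset K.

Definition conv_hull A : set Y := smallest (@convex_set R Y) A.

Definition is_seminorm psi : Prop :=
  (forall y z, psi (y + z) <= psi y + psi z) /\
  (forall (t : R) y, psi (t *: y) = `|t| * psi y).

Definition unit_ball psi : set Y := [set y | psi y <= 1].

Definition base_of psi M : set Y := [set x | M x /\ psi x = 1].

Definition conv_base psi M : set Y := conv_hull (base_of psi M).

Definition conv_base0 psi M : set Y := conv_hull ([set 0] `|` base_of psi M).

(* [base_of psi M] is a normlike-base for [M] *)
Definition normlike_base psi M : Prop :=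
  [/\ is_cone M, nontrivial M & forall y, M y -> y != 0 -> 0 < psi y].

(* The Bishop-Phelps type cone C_psi(u, alpha) *)
Definition bp_cone psi (u : Y -> R) (alpha : R) : set Y :=
  [set y | alpha * psi y <= u y].

Definition sublinear phi : Prop :=
  (forall y z, phi (y + z) <= phi y + phi z) /\
  (forall (t : R) y, 0 < t -> phi (t *: y) = t * phi y).

(* [phi] is [- C] representing *)
Definition represents_opp phi C : Prop := oppset C = [set y | phi y <= 0].

(* The Gerstewitz functional phi^G_{E,k}; [ereal_inf set0 = +oo]. *)
Definition gerstewitz (E : set Y) k (y : Y) : \bar R :=
  ereal_inf [set t%:E | t in [set t : R | addset [set t *: k] E y]].

End LinearSpace.

Section Dual.
Context {R : realType} {Y : topologicalLmodType R}.

Definition dual_space : set (Y -> R^o) := [set u | linear u /\ continuous u].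

(* The augmented dual cone K^{a#}(psi) *)
Definition aug_dual (psi : Y -> R) (K : set Y) : set ((Y -> R^o) * R) :=
  [set p | [/\ dual_space p.1, 0 <= p.2 &
    forall y, (K `\ 0) y -> 0 < p.1 y - p.2 * psi y]].

End Dual.

Definition argmin {X : Type} {d : Order.disp_t} {T : porderType d}
    (D : set X) (g : X -> T) : set X :=
  [set x | D x /\ forall z, D z -> (g x <= g z)%O].

Section VectorOptimization.
Context {R : realType} {X : Type} {Y : lmodType R}.
Variables (Omega : set X) (f : X -> Y).

Definition Eff (C : set Y) : set X :=
  [set xbar | Omega xbar /\
    ~ exists2 x, Omega x & addset [set f xbar] (oppset (C `\ 0)) (f x)].

Definition PEff (AA : X -> set Y) (K : set Y) : set X :=
  [set xbar | Eff K xbar /\ AA xbar `&` oppset K = [set 0]].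

(* Feasible pairs and solutions of the problem (P_phi^{a,k}) *)
Definition P_feasible (phi : Y -> R) (a k : Y) : set (X * R) :=
  [set p | Omega p.1 /\ phi (f p.1 - a - p.2 *: k) <= 0].

Definition P_solutions (phi : Y -> R) (a k : Y) : set (X * R) :=
  argmin (P_feasible phi a k) snd.

End VectorOptimization.

(* Main.v *)
Require Import Defs.
From HB Require Import structures.
From mathcomp Require Import all_boot all_order all_algebra.
From mathcomp Require Import all_classical all_reals all_analysis.
From mathcomp Require Import lra.

Set Implicit Arguments.
Unset Strict Implicit.
Unset Printing Implicit Defensive.

Import Order.TTheory GRing.Theory Num.Theory.
Import numFieldNormedType.Exports.

Local Open Scope classical_set_scope.
Local Open Scope ring_scope.

(* The cones are separated through their bases. A continuous linear [u] that
   strictly separates the disjoint convex sets [cl S_{-K}] and [cl S^0_A], with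
   a value [- alpha] in between, satisfies [u > alpha psi] on [K \ {0}] and
   [u > - alpha psi] on [A \ {0}], and [alpha > 0] because [0] lies in [S^0_A].
   Disjointness holds in case (a) because the intersection lies in
   [A n (-K) = {0}] and [0] is not in [cl S_{-K}]. In case (b), a point of
   [A n cl B_A] with [y* >= beta] would lie in [cl S_{-K}], hence in
   [A n (-K)], so [y* < beta] there, and this passes to convex hulls.
   Since [f[Omega] - f(xbar)] avoids [- C] outside [0], properties (i)-(iv) come
   from the behaviour of [C] along the line spanned by [k].

   Hahn-Banach is obtained from Zorn's lemma applied to the sublinear
   functionals below a given one. *)

(** * Convexity with real coefficients *)

Lemma convex_setP (R : realType) (Y : lmodType R) (A : set Y) :
  convex_set A <-> forall x y (t : R), 0 <= t <= 1 -> A x -> A y ->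
    A (t *: x + (1 - t) *: y).
Proof.
split=> [cA x y t t01 Ax Ay|cA x y t].
  by have /set_mem := cA x y (Itv01 (andP t01).1 (andP t01).2)
    (mem_set Ax) (mem_set Ay).
move=> /set_mem Ax /set_mem Ay; apply/mem_set.
by apply: (cA _ _ t%:num) => //; apply/andP; split.
Qed.

(** If [s + t = 0], both coefficients vanish and any point serves; otherwise [z] is the combination
    normalised by [s + t]. This merges two rays through a convex set into one, which gives the
    subadditivity of the infima below. *)
Lemma convex_comb (R : realType) (Y : lmodType R) (A : set Y) x y (s t : R) :
  convex_set A -> 0 <= s -> 0 <= t -> A x -> A y ->
  exists2 z, A z & s *: x + t *: y = (s + t) *: z.
Proof.
move=> /convex_setP cA s0 t0 Ax Ay; have [st0|st0] := eqVneq (s + t) 0.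
  exists x => //; have /eqP s00 : s == 0 by rewrite eq_le s0 andbT; lra.
  by have -> : t = 0; [lra|rewrite s00 addr0 !scale0r addr0].
have stp : 0 < s + t by rewrite lt_neqAle eq_sym st0 addr_ge0.
exists ((s / (s + t)) *: x + (1 - s / (s + t)) *: y).
  by apply: cA => //; rewrite divr_ge0 ?addr_ge0//= ler_pdivrMr// mul1r; lra.
rewrite scalerDr !scalerA mulrC divfK//; congr (_ + _ *: _).
by rewrite mulrBr mulr1 [X in _ - X]mulrC divfK//; lra.
Qed.

(** * Sublinear functionals and the Hahn-Banach theorem *)

Section HahnBanach.
Context {R : realType} {Y : lmodType R}.
Implicit Types (p q : Y -> R) (D : set Y).

Lemma sublinear0 p : sublinear p -> p 0 = 0.
Proof. by move=> [_ /(_ 2 0 (ltr0Sn _ _))]; rewrite scaler0; lra. Qed.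

Lemma sublinearN p x : sublinear p -> - p (- x) <= p x.
Proof.
move=> sp; have := sp.1 x (- x); rewrite subrr (sublinear0 sp); lra.
Qed.

(** Common tool for three infima: the lowering of a sublinear functional, the lower bound of a
    chain, and the Minkowski gauge. *)
Lemma inf_sublinear (S : Y -> set R) :
    (forall x, has_inf (S x)) ->
    (forall x y s t, S x s -> S y t ->
      exists2 r, S (x + y) r & r <= s + t) ->
    (forall x s t, 0 < t -> S x s -> S (t *: x) (t * s)) ->
  sublinear (fun x => inf (S x)).
Proof.
move=> infS addS mulS.
have mul_le t x : 0 < t -> inf (S (t *: x)) <= t * inf (S x).
  move=> t0; rewrite -ler_pdivrMl//; apply: lb_le_inf; first exact: (infS x).1.
  move=> s Ss; rewrite ler_pdivrMl//; apply: ge_inf; first exact: (infS _).2.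
  exact: mulS.
split=> [x y|t x t0].
  rewrite -lerBlDr; apply: lb_le_inf; first exact: (infS x).1.
  move=> s Ss; rewrite lerBlDr -lerBlDl; apply: lb_le_inf.
    exact: (infS y).1.
  move=> r Sr; rewrite lerBlDl; have [z Sz] := addS _ _ _ _ Ss Sr.
  by apply: le_trans; apply: ge_inf Sz; exact: (infS _).2.
apply/le_anti; rewrite mul_le//= -ler_pdivlMl//.
(* The reverse inequality is the one already proved, for the factor [t^-1] at the point [t *: x]. *)
have := mul_le t^-1 (t *: x); rewrite invr_gt0 => /(_ t0).
by rewrite scalerA mulVf ?gt_eqF// scale1r.
Qed.

(* The witness is [x |-> inf_(t >= 0, d in D) (p (x + t d) - t c)]. *)
Lemma sublinear_lower p D (c : R) :
    sublinear p -> convex_set D -> D !=set0 -> (forall d, D d -> c <= p d) ->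
  exists q, [/\ sublinear q, forall x, q x <= p x &
    forall d, D d -> q (- d) <= - c].
Proof.
move=> sp cD [d0 Dd0] cp.
pose S x := [set s | exists2 t, 0 <= t &
  exists2 d, D d & s = p (x + t *: d) - t * c].
have lbS x : lbound (S x) (- p (- x)).
  move=> _ [t t0 [d Dd ->]].
  have : t * c <= p (t *: d).
    move: t0; rewrite le_eqVlt => /predU1P[<-|t0].
      by rewrite scale0r mul0r sublinear0.
    by rewrite sp.2// ler_pM2l//; exact: cp.
  have := sp.1 (x + t *: d) (- x); rewrite addrAC subrr add0r; lra.
have pS x : S x (p x).
  by exists 0 => //; exists d0; rewrite // scale0r addr0 mul0r subr0.
exists (fun x => inf (S x)); split.
- apply: inf_sublinear => [x|x y a b [s s0 [d Dd ->]] [t t0 [e De ->]]|x a t t0].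
  + by split; [exists (p x)|exists (- p (- x))].
  (* The two shifts [s *: d] and [t *: e] add up to the single shift [(s + t) *: z] with [z] in
     [D]. *)
  + have [z Dz Ez] := convex_comb cD s0 t0 Dd De.
    exists (p (x + y + (s + t) *: z) - (s + t) * c).
      by exists (s + t); [exact: addr_ge0|exists z].
    by have := sp.1 (x + s *: d) (y + t *: e); rewrite addrACA Ez; lra.
  + move=> [s s0 [d Dd ->]]; rewrite /S/=.
    exists (t * s); first by rewrite mulr_ge0// ltW.
    exists d => //; rewrite -scalerA -scalerDr sp.2//; lra.
- by move=> x; apply: ge_inf => //; exists (- p (- x)).
(* At [- d] the parameters [t = 1] and [d] give the value [p 0 - c = - c]. *)
- move=> d Dd; apply: ge_inf; first by exists (- p (- - d)).
  exists 1 => //; exists d => //; rewrite scale1r addNr sublinear0//; lra.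
Qed.

(* A minimal sublinear functional below [p] is linear. *)
Lemma hahn_banach p : sublinear p ->
  exists2 u : Y -> R^o, linear u & forall x, u x <= p x.
Proof.
move=> sp; pose P (q : Y -> R) := sublinear q /\ forall x, q x <= p x.
pose T := {q | P q}.
(* The order is reversed, so that a maximal element for Zorn's lemma is a minimal functional. *)
pose ord (s t : T) := `[< forall x, sval t x <= sval s x >].
have [||C totC|[u [su up]] minu] :=
  @ZL_preorder T (exist P p (conj sp (fun=> lexx _))) ord.
- by move=> t; apply/asboolP.
- move=> r s t /asboolP rs /asboolP st; apply/asboolP => x.
  exact: le_trans (st x) (rs x).
- have [C0|/set0P[q0 Cq0]] := eqVneq C set0.
    rewrite C0; by exists (exist P p (conj sp (fun=> lexx _))) => ?.
  pose S x := [set sval q x | q in C].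
  have lbS x : lbound (S x) (- p (- x)).
    move=> _ [[q [sq qp]] Cq <-] /=.
    by apply: le_trans (sublinearN _ sq); rewrite lerN2.
  have infS x : has_inf (S x).
    by split; [exists (sval q0 x), q0|exists (- p (- x))].
  have sS : sublinear (fun x => inf (S x)).
    apply: inf_sublinear => // [x y a b [q Cq <-] [r Cr <-]|x a t t0 [q Cq <-]].
      (* Of two members of the chain, the smaller one evaluated at [x + y] bounds the sum. *)
      have [/asboolP qr|/asboolP rq] := totC q r Cq Cr.
        exists (sval r (x + y)); first by exists r.
        by apply: le_trans ((svalP r).1.1 _ _) _; rewrite lerD2r.
      exists (sval q (x + y)); first by exists q.
      by apply: le_trans ((svalP q).1.1 _ _) _; rewrite lerD2l.
    by exists q => //; rewrite (svalP q).1.2.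
  have Sp x : inf (S x) <= p x.
    apply: le_trans ((svalP q0).2 x); apply: ge_inf; first exact: (infS x).2.
    by exists q0.
  exists (exist P _ (conj sS Sp)) => q Cq; apply/asboolP => x /=.
  by apply: ge_inf; [exact: (infS x).2|exists q].
(* Lowering [u] along [v] gives [q <= u] with [q (- v) <= - u v]; minimality gives [u <= q], so [u]
   is odd. Oddness turns subadditivity into additivity. *)
have uN v : u (- v) = - u v.
  have [|||q [sq qu qv]] := @sublinear_lower u [set v] (u v) su.
  - by apply/convex_setP => _ _ t _ -> ->; rewrite -scalerDl addrC subrK scale1r.
  - by exists v.
  - by move=> _ ->.
  have qp x : q x <= p x by apply: le_trans (qu x) (up x).
  have /asboolP/= uq : ord (exist P q (conj sq qp)) (exist P u (conj su up)).
    by apply: minu; apply/asboolP => x /=.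
  apply/le_anti; rewrite (le_trans (uq _) (qv _ erefl))/=.
  by have := sublinearN (- v) su; rewrite opprK; lra.
have uD x y : u (x + y) = u x + u y.
  apply/le_anti; rewrite su.1/=.
  have := su.1 (- x) (- y); rewrite -opprD !uN; lra.
exists u => // t x y; rewrite uD; congr (_ + _).
have [t0|t0|<-] := ltgtP 0 t; first exact: su.2.
  rewrite -[t]opprK scaleNr uN su.2 ?oppr_gt0//.
  by rewrite scaleNr -mulNr.
by rewrite !scale0r sublinear0.
Qed.
End HahnBanach.

(** * Computation rules for linear functionals *)

Section LinearFunctional.
Context {R : realType} {Y : lmodType R} (u : Y -> R^o) (lu : linear u).

Lemma linear_funD x y : u (x + y) = u x + u y.
Proof. by have := lu 1 x y; rewrite !scale1r. Qed.

Lemma linear_fun0 : u 0 = 0.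
Proof. by have := linear_funD 0 0; rewrite addr0; lra. Qed.

Lemma linear_funZ (t : R) x : u (t *: x) = t * u x.
Proof. by have := lu t x 0; rewrite !addr0 linear_fun0 addr0. Qed.

Lemma linear_funN x : u (- x) = - u x.
Proof. by rewrite -scaleN1r linear_funZ mulN1r. Qed.

End LinearFunctional.

(** * Gauges and strict separation in locally convex spaces *)

Section Separation.
Context {R : realType} {Y : tvsType R}.
Implicit Types (u : Y -> R^o) (W P Q : set Y).

Lemma nbhs0_absorbing W (x : Y) : nbhs 0 W -> exists2 t : R, 0 < t & W (t *: x).
Proof.
move=> W0; have /= := @scale_continuous _ Y (0, x) W.
rewrite scale0r => /(_ W0) [[U V] /= [U0 Vx] UVW].
have /nbhs_ballP[e /= e0 eU] := U0.
exists (e / 2); first by rewrite divr_gt0.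
apply: (UVW (e / 2, x)); split => /=; last exact: nbhs_singleton.
apply: eU; rewrite -ball_normE /= sub0r normrN.
rewrite ger0_norm; last by rewrite divr_ge0// ltW.
by rewrite ltr_pdivrMr// ltr_pMr// ltr1n.
Qed.

(** A one-sided bound on [W] is enough: on the intersection of [e W] with [- e W] it becomes
    two-sided, and that neighbourhood is translated to [x]. *)
Lemma bounded_linear_continuous u W :
  linear u -> nbhs 0 W -> (forall w, W w -> u w <= 1) -> continuous u.
Proof.
move=> lu W0 uW x; apply/cvgrPdist_le => e e0.
have eW : nbhs (0 : Y) ( *:%R e @` W) by apply: nbhs0Z => //; rewrite gt_eqF.
have eNW := nbhs0N eW.
have : nbhs x (+%R x @` (( *:%R e @` W) `&` (-%R @` ( *:%R e @` W)))).
  exact/nbhsT/filterI.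
apply: filterS => _ [_ [[w Ww <-] [_ [z Wz <-] zw]] <-].
have uw : u (e *: w) <= e by rewrite (linear_funZ lu) ger_pMr// uW.
have uz : - u (e *: w) <= e.
  by rewrite -zw (linear_funN lu) opprK (linear_funZ lu) ger_pMr// uW.
by rewrite (linear_funD lu) opprD addNKr normrN ler_norml; apply/andP; split; lra.
Qed.

(** The Minkowski functional of [W]. If [t < 1] and [t^-1 *: x] is in [W], then [x] is a convex
    combination of that point and [0], so it lies in [W]; hence the lower bound 1 outside [W]. *)
Lemma exists_gauge W : convex_set W -> nbhs 0 W ->
  exists p : Y -> R, [/\ sublinear p, forall w, W w -> p w <= 1 &
    forall x, ~ W x -> 1 <= p x].
Proof.
move=> cW W0; pose S x := [set t : R | 0 < t /\ W (t^-1 *: x)].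
have infS x : has_inf (S x).
  split; last by exists 0 => t [/ltW].
  have [t t0 Wt] := nbhs0_absorbing x W0.
  by exists t^-1; split; rewrite ?invr_gt0 ?invrK.
exists (fun x => inf (S x)); split.
- apply: inf_sublinear => // [x y s t [s0 Ws] [t0 Wt]|x s t t0 [s0 Ws]].
    exists (s + t) => //; split; first exact: addr_gt0.
    have [z Wz] := convex_comb cW (ltW s0) (ltW t0) Ws Wt.
    rewrite !scalerA !divff ?gt_eqF// !scale1r => ->.
    by rewrite scalerA mulVf ?scale1r// gt_eqF// addr_gt0.
  split; first exact: mulr_gt0.
  by rewrite scalerA invfM mulrAC mulVf ?gt_eqF// mul1r.
- by move=> w Ww; apply: ge_inf; [exact: (infS w).2|split; rewrite // invr1 scale1r].
- move=> x nWx; apply: lb_le_inf; first exact: (infS x).1.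
  move=> t [t0 Wt]; rewrite leNgt; apply/negP => t1; apply: nWx.
  have /convex_setP cW' := cW.
  have := cW' _ 0 t _ Wt (nbhs_singleton W0).
  rewrite scaler0 addr0 scalerA divff ?gt_eqF// scale1r; apply.
  by rewrite !ltW.
Qed.

Lemma nbhs0_convex W : nbhs (0 : Y) W ->
  exists V, [/\ convex_set V, nbhs 0 V & V `<=` W].
Proof.
move=> W0; have [B cB [oB nB]] := @locally_convex R Y.
have [V [BV V0] VW] := nB 0 W W0; exists V; split => //.
  by apply: cB; exact: mem_set.
by apply: open_nbhs_nbhs; split => //; exact: oB.
Qed.

(** Near each [x] in [P], continuity of addition at [(x, 0)] keeps [x + w] in the open complement of
    [Q]; compactness makes the neighbourhood of [w] uniform. *)
Lemma compact_closed_gap P Q : compact P -> closed Q -> P `&` Q = set0 ->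
  \forall w \near (0 : Y), forall x, P x -> ~ Q (x + w).
Proof.
move=> /compact_near_coveringP cP clQ PQ.
apply: (cP _ (nbhs (0 : Y)) (fun w x => ~ Q (x + w))) => x Px.
have oQ : open (~` Q) by exact: closed_openC.
have /= := @add_continuous Y (x, 0) (~` Q); rewrite addr0; apply.
apply: open_nbhs_nbhs; split=> // Qx.
by have : set0 x by rewrite -PQ.
Qed.

(** The differences [x - y] avoid a convex neighbourhood [V] of 0, so its gauge is at least 1 on
    them. Lowering the gauge along this convex set and applying Hahn-Banach gives
    [u (y - x) <= - 1]; [u] is continuous because it stays below the gauge. *)
Lemma strict_separation P Q : convex_set P -> convex_set Q ->
    P !=set0 -> Q !=set0 ->
    compact (closure P) \/ compact (closure Q) ->
    closure P `&` closure Q = set0 ->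
  exists2 u : Y -> R^o, dual_space u &
    forall x y, P x -> Q y -> u y + 1 <= u x.
Proof.
move=> cP cQ [x0 Px0] [y0 Qy0] cpt PQ.
have [W W0 PQW] : exists2 W, nbhs (0 : Y) W &
    forall x y, P x -> Q y -> ~ W (x - y).
  case: cpt => [cpP|cpQ].
    have := compact_closed_gap cpP (@closed_closure _ Q) PQ.
    (* With [P] compact the gap concerns [w = y - x], so the neighbourhood is reflected; with [Q]
       compact it concerns [x - y] directly. *)
    move=> /nbhs0N gap; eexists; first exact: gap.
    move=> x y Px Qy [w gw wE].
    apply: (gw x); first exact: subset_closure.
    by rewrite -[w]opprK wE opprB addrC subrK; exact: subset_closure.
  rewrite setIC in PQ.
  have gap := compact_closed_gap cpQ (@closed_closure _ P) PQ.
  eexists; first exact: gap.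
  move=> x y Px Qy /(_ y (subset_closure Qy)); apply.
  by rewrite addrC subrK; exact: subset_closure.
have [V [cV V0 VW]] := nbhs0_convex W0.
have [p [sp pV p1]] := exists_gauge cV V0.
have [||d [x Px [y Qy <-]]|q [sq qp qD]] :=
  @sublinear_lower _ _ p [set z | exists2 x, P x & exists2 y, Q y & x - y = z] 1 sp.
- apply/convex_setP => _ _ t t01 [x Px [y Qy <-]] [x' Px' [y' Qy' <-]].
  exists (t *: x + (1 - t) *: x'); first by move/convex_setP: cP; apply.
  exists (t *: y + (1 - t) *: y'); first by move/convex_setP: cQ; apply.
  by rewrite !scalerBr opprD addrACA.
- by exists (x0 - y0), x0 => //; exists y0.
- by apply: p1 => /VW; exact: PQW.
have [u lu uq] := hahn_banach sq.
exists u => [|x y Px Qy].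
  split => //; apply: (bounded_linear_continuous lu V0) => w Vw.
  by apply: le_trans (uq w) _; apply: le_trans (qp w) (pV w Vw).
have := le_trans (uq _) (qD (x - y) _).
rewrite opprB (linear_funD lu) (linear_funN lu).
suff : exists2 x', P x' & exists2 y', Q y' & x' - y' = x - y by move=> h /(_ h); lra.
by exists x => //; exists y.
Qed.

End Separation.

Lemma oppsetE (R : realType) (Y : lmodType R) (A : set Y) y :
  oppset A y <-> A (- y).
Proof.
by split=> [[z Az <-]|Ay]; [rewrite opprK|exists (- y); rewrite ?opprK].
Qed.

(** * Seminorms and Bishop-Phelps type cones *)

Section Seminorm.
Context {R : realType} {Y : lmodType R} (psi : Y -> R).
Hypothesis psi_seminorm : is_seminorm psi.

Lemma seminorm0 : psi 0 = 0.
Proof. by have := psi_seminorm.2 0 0; rewrite scaler0 normr0 mul0r. Qed.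

Lemma seminormN y : psi (- y) = psi y.
Proof. by rewrite -scaleN1r psi_seminorm.2 normrN1 mul1r. Qed.

Variables (u : Y -> R^o) (alpha : R).
Hypotheses (lu : linear u) (alpha_ge0 : 0 <= alpha).
Notation C := (bp_cone psi u alpha).

Lemma bp_cone0 : C 0.
Proof. by rewrite /bp_cone /= seminorm0 mulr0 (linear_fun0 lu). Qed.

Lemma bp_coneD y z : C y -> C z -> C (y + z).
Proof.
rewrite /bp_cone /= (linear_funD lu) => Cy Cz; apply: le_trans (lerD Cy Cz).
by rewrite -mulrDr ler_wpM2l// psi_seminorm.1.
Qed.

Lemma bp_coneZ (t : R) y : 0 <= t -> C y -> C (t *: y).
Proof.
rewrite /bp_cone /= (linear_funZ lu) psi_seminorm.2 => t0 Cy.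
by rewrite ger0_norm// mulrCA ler_wpM2l.
Qed.

(** By the triangle inequality, membership of [y + e *: k] bounds [alpha * psi y - u y] by [e] times
    a constant; then [e] tends to 0. *)
Lemma bp_cone_ray_closed y k :
  (forall e : R, 0 < e -> C (y + e *: k)) -> C y.
Proof.
rewrite /bp_cone /= => Cyk.
have Cy (e : R) : 0 < e -> alpha * psi y <= u y + e * (u k + alpha * psi k).
  move=> e0; have := Cyk e e0; rewrite (linear_funD lu) (linear_funZ lu).
  have := psi_seminorm.1 (y + e *: k) (- (e *: k)).
  rewrite addrK seminormN psi_seminorm.2 gtr0_norm// => /(ler_wpM2l alpha_ge0).
  by rewrite !mulrDr (mulrCA alpha); lra.
set c := u k + alpha * psi k in Cy.
apply/ler_addgt0Pr => e e0.
(* Adding 1 keeps the denominator positive even when [c = 0]. *)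
have c0 : 0 < `|c| + 1 by rewrite ltr_wpDl.
apply: le_trans (Cy _ (divr_gt0 e0 c0)) _; rewrite lerD2l.
rewrite mulrAC ler_pdivrMr// ler_pM2l//.
by apply: le_trans (ler_norm c) _; rewrite lerDl.
Qed.

End Seminorm.

(** * Efficient points and scalarization along a ray *)

Section EfficientPoint.
Context {R : realType} {X : Type} {Y : lmodType R}.
Variables (Omega : set X) (f : X -> Y) (C : set Y) (xbar : X).
Hypotheses (C_0 : C 0) (C_D : forall y z, C y -> C z -> C (y + z))
  (C_Z : forall (t : R) y, 0 <= t -> C y -> C (t *: y)).
Hypothesis xbar_Eff : Eff Omega f C xbar.

Lemma Eff_eq x : Omega x -> C (f xbar - f x) -> f x = f xbar.
Proof.
move=> Ox Cx; apply: contrapT => fx; apply: xbar_Eff.2; exists x => //.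
exists (f xbar) => //; exists (f x - f xbar); last by rewrite addrC subrK.
apply/oppsetE; rewrite opprB; split=> // /eqP; rewrite subr_eq0 => /eqP.
by move=> fE; apply: fx.
Qed.

Variable k : Y.
Hypothesis kC : (C `\` linspace C) k.

Lemma pointed_ray (t : R) : C (t *: k) -> 0 <= t.
Proof.
move=> Ctk; rewrite leNgt; apply/negP => t0; apply: kC.2; split; first exact: kC.1.
apply/oppsetE; have : 0 <= - t^-1 by rewrite oppr_ge0 invr_le0 ltW.
move=> /C_Z/(_ Ctk); rewrite scalerA mulNr mulVf ?lt_eqF//.
by rewrite scaleN1r.
Qed.

(** For [t <= 0] the vector [(- t) *: k] lies in [C]; adding it leaves [f xbar - f x] in [C], so
    efficiency gives equality. Then [t *: k] is in [C], which forces [t >= 0] since [k] is outside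
    the lineality space. *)
Lemma Eff_ray x (t : R) :
  Omega x -> t <= 0 -> C (f xbar + t *: k - f x) -> f x = f xbar /\ t = 0.
Proof.
move=> Ox t0 Cx; have fx : f x = f xbar.
  apply: Eff_eq => //.
  have := C_D Cx (C_Z (_ : 0 <= - t) kC.1); rewrite oppr_ge0 => /(_ t0).
  by rewrite scaleNr addrAC addrK.
split=> //; move: Cx; rewrite fx addrAC subrr add0r => /pointed_ray; lra.
Qed.

Variables (a : Y) (s : R).
Hypothesis xbarE : f xbar = a + s *: k.

(** Serves both (i), with [a = f xbar] and [s = 0], and (iii). *)
Lemma Eff_P_solutions (phi : Y -> R) : represents_opp phi C ->
  [set p | Omega p.1 /\ f p.1 = f xbar /\ p.2 = s] = P_solutions Omega f phi a k.
Proof.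
move=> phiC; have phiE y : phi y <= 0 <-> C (- y).
  rewrite -oppsetE phiC //.
(* Since [a + t *: k = f xbar + (t - s) *: k], feasibility no longer involves [a], and [Eff_ray]
   applies to [t - s]. *)
have feas x t : P_feasible Omega f phi a k (x, t) <->
    Omega x /\ C (f xbar + (t - s) *: k - f x).
  rewrite /P_feasible/= phiE xbarE scalerBl !opprB.
  by rewrite addrACA subrr addr0 (addrC a) addrA.
apply/seteqP; split=> [[x t] /= [Ox [fx ->]]|[x t] [/feas[Ox Cx] mint]] /=.
  split; first by apply/feas; rewrite subrr scale0r addr0 fx subrr.
  move=> [z r] /feas[Oz Cz] /=; rewrite leNgt; apply/negP => rs.
  have [|_] := Eff_ray Oz _ Cz; lra.
have /mint /= ts : P_feasible Omega f phi a k (xbar, s).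
  by apply/feas; rewrite subrr scale0r addr0 subrr; split => //; exact: xbar_Eff.1.
by have [|fx] := Eff_ray Ox _ Cx; [lra|split=> //; split=> //; lra].
Qed.

Hypothesis C_ray_closed :
  forall y, (forall e : R, 0 < e -> C (y + e *: k)) -> C y.

Let E := addset [set a] (oppset C).

(** The level sets of the Gerstewitz functional obey the same condition as feasibility of [(x, t)]
    in the scalar problem. *)
Lemma gerstewitz_levelE x (t : R) :
  addset [set t *: k] E (f x) <-> C (f xbar + (t - s) *: k - f x).
Proof.
have -> : f xbar + (t - s) *: k - f x = t *: k + a - f x.
  by rewrite xbarE scalerBl addrACA subrr addr0 (addrC a).
split=> [[_ -> [_ [_ -> [_ [c Cc <-] <-]] <-]]|Cx].
  by rewrite addrA opprD opprK addrA subrr add0r.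
exists (t *: k) => //; exists (f x - t *: k); last by rewrite addrC subrK.
exists a => //; exists (f x - t *: k - a); last by rewrite addrC subrK.
by apply/oppsetE; rewrite -addrA -opprD opprB.
Qed.

Lemma gerstewitz_xbar x : Omega x -> f x = f xbar -> gerstewitz E k (f x) = s%:E.
Proof.
move=> Ox fx; apply/le_anti/andP; split.
  apply: ereal_inf_lbound; exists s => //; apply/gerstewitz_levelE.
  by rewrite fx subrr scale0r addr0 subrr.
apply: le_ereal_inf_tmp => _ [t /gerstewitz_levelE Ct <-]; rewrite lee_fin.
by move: Ct; rewrite fx addrAC subrr add0r => /pointed_ray; lra.
Qed.

Lemma gerstewitz_le x : Omega x -> (gerstewitz E k (f x) <= s%:E)%E ->
  f x = f xbar.
Proof.
(* The infimum need not be attained: a level [t < s + e] is raised to [s + e] by adding a multiple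
   of [k], and closedness along [k] removes [e]. *)
move=> Ox gx; apply: Eff_eq => //; apply: C_ray_closed => e e0.
have : (gerstewitz E k (f x) < (s + e)%:E)%E.
  by apply: le_lt_trans gx _; rewrite lte_fin ltrDl.
move=> /ereal_inf_lt[_ [t /gerstewitz_levelE Ct <-]]; rewrite lte_fin => te.
have := C_D Ct (C_Z (_ : 0 <= s + e - t) kC.1); rewrite subr_ge0 => /(_ (ltW te)).
suff -> : e *: k = (t - s) *: k + (s + e - t) *: k.
  by rewrite addrA (addrAC (f xbar) (- f x)).
by rewrite -scalerDl; congr (_ *: _); lra.
Qed.

Lemma Eff_gerstewitz :
  gerstewitz E k (f xbar) = s%:E /\
  [set x | Omega x /\ f x = f xbar] = argmin Omega (fun x => gerstewitz E k (f x)).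
Proof.
have Oxb := xbar_Eff.1; split; first exact: gerstewitz_xbar.
apply/seteqP; split=> [x [Ox fx]|x [Ox minx]].
  split=> // z Oz; rewrite gerstewitz_xbar// leNgt; apply/negP => zs.
  by move: (zs); rewrite gerstewitz_xbar ?ltxx//; exact: gerstewitz_le (ltW zs).
split=> //; apply: gerstewitz_le => //.
by rewrite -(gerstewitz_xbar Oxb erefl); exact: minx.
Qed.

End EfficientPoint.

(** * Hulls, half-spaces and bounds on compact sets *)

Section ConvexSets.
Context {R : realType} {Y : lmodType R}.
Implicit Types (A B C : set Y).

Lemma convex_conv_hull A : convex_set (conv_hull A).
Proof.
apply/convex_setP => x y t t01 Ax Ay C [/[dup] /convex_setP cC cC' AC].
by apply: cC => //; [exact: Ax|exact: Ay].
Qed.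

Lemma convex_oppset A : convex_set A -> convex_set (oppset A).
Proof.
move=> /convex_setP cA; apply/convex_setP => x y t t01 /oppsetE Ax /oppsetE Ay.
by apply/oppsetE; rewrite opprD -!scalerN; exact: cA.
Qed.

Lemma convex_le (u : Y -> R^o) (c : R) : linear u ->
  convex_set [set x | u x <= c].
Proof.
move=> lu; apply/convex_setP => x y t /andP[t0 t1] /= ux uy.
rewrite (linear_funD lu) !(linear_funZ lu).
have := ler_wpM2l t0 ux; have /ler_wpM2l/(_ _ _ uy) : 0 <= 1 - t by rewrite subr_ge0.
lra.
Qed.

(** Two given points lie in the closed half-space at level [max (u x) (u y)], which is still below
    [c]. *)
Lemma convex_lt (u : Y -> R^o) (c : R) : linear u ->
  convex_set [set x | u x < c].
Proof.
move=> lu; apply/convex_setP => x y t t01 /= ux uy.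
have /convex_setP := convex_le (c := Num.max (u x) (u y)) lu.
move=> /(_ x y t t01) /= h; apply: le_lt_trans (h _ _) _.
- by rewrite le_max lexx.
- by rewrite le_max lexx orbT.
- by rewrite gt_max ux.
Qed.

End ConvexSets.

Lemma closed_oppset (R : realType) (Y : tvsType R) (A : set Y) :
  closed A -> closed (oppset A).
Proof.
move=> clA; have -> : oppset A = -%R @^-1` A by apply/predeqP => y; exact: oppsetE.
by apply: closed_comp => // x _; exact: opp_continuous.
Qed.

(** Compactness makes a local margin [e] uniform; this also covers an empty [G], where no maximum
    exists. *)
Lemma compact_lt_le (R : realType) (T : topologicalType) (v : T -> R^o) (G : set T)
    (beta : R) : continuous v -> compact G -> (forall x, G x -> v x < beta) ->
  exists2 m, m < beta & forall x, G x -> v x <= m.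
Proof.
move=> cv /compact_near_coveringP cG vG.
have : \forall e \near (0 : R)^'+, G `<=` [set x | v x <= beta - e].
  apply: (cG _ _ (fun e x => v x <= beta - e)) => x Gx.
  (* Half of the gap absorbs the variation of [v] near [x], the other half the margin [e]. *)
  have d0 : 0 < (beta - v x) / 2 by rewrite divr_gt0// subr_gt0 vG.
  exists ([set y | v y < v x + (beta - v x) / 2], [set e | e < (beta - v x) / 2]).
    split => /=; last exact: nbhs_right_lt.
    apply: (cv x [set r : R | r < v x + (beta - v x) / 2]).
    by apply: lt_nbhsl; rewrite ltrDl.
  by move=> [y e] [/= vy ed]; lra.
move=> near_e; have [e [e0 Ge]] :
    exists e : R, 0 < e /\ G `<=` [set x | v x <= beta - e].
  by apply: (@filter_ex _ (0^'+)); apply: filterI => //; exact: nbhs_right_gt.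
by exists (beta - e); [lra|exact: Ge].
Qed.

(** * Separation of cones through their normlike bases *)

Section Bases.
Context {R : realType} {Y : tvsType R} (psi : Y -> R) (K A : set Y).
Hypothesis psi_seminorm : is_seminorm psi.

Lemma is_coneZ M (t : R) (y : Y) : is_cone M -> 0 <= t -> M y -> M (t *: y).
Proof.
move=> [_ <-] t0 [s s0 [z Mz <-]]; rewrite scalerA.
by exists (t * s); [exact: mulr_ge0|exists z].
Qed.

Lemma normlike_base_scale M y : normlike_base psi M -> M y -> y != 0 ->
  base_of psi M ((psi y)^-1 *: y).
Proof.
move=> [cM _ M0] My y0; have py := M0 y My y0; split.
  by apply: is_coneZ => //; rewrite invr_ge0 ltW.
by rewrite psi_seminorm.2 ger0_norm ?invr_ge0 ?ltW// mulVf// gt_eqF.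
Qed.

Lemma normlike_base_neq0 M : normlike_base psi M -> exists y, base_of psi M y.
Proof.
move=> /[dup] nM [[M0 _] [nM0 _] _].
have [y My y0] : exists2 y, M y & y != 0.
  apply: contrapT => h; apply: nM0; apply/seteqP; split=> [_ ->|y My] //=.
  by apply: contrapT => /eqP y0; apply: h; exists y.
by exists ((psi y)^-1 *: y); exact: normlike_base_scale.
Qed.

Lemma base_of_opp y : base_of psi (oppset K) y <-> base_of psi K (- y).
Proof.
by split=> -[/oppsetE Ky py]; split; rewrite ?seminormN// -?oppsetE// in py *.
Qed.

Hypotheses (K_closed : closed K) (K_convex : convex_set K).

(** The set [- K] is closed, convex and contains its base. *)
Lemma closure_conv_base_opp : closure (conv_base psi (oppset K)) `<=` oppset K.
Proof.
rewrite [X in _ `<=` X](closure_id _).1; last exact: closed_oppset.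
apply: closure_subset; apply: smallest_sub; first exact: convex_oppset.
by move=> y [].
Qed.

Hypothesis KA : A `&` oppset K = [set 0].

Lemma disjoint_closed_convex :
    A 0 -> closed A -> convex_set A -> ~ closure (conv_base psi (oppset K)) 0 ->
  closure (conv_base0 psi A) `&` closure (conv_base psi (oppset K)) = set0.
Proof.
move=> A0 clA cA K0; apply/seteqP; split=> // y [Ay Ky].
have : [set 0] y.
  rewrite -KA; split; last exact: closure_conv_base_opp.
  rewrite [A](closure_id _).1//; apply: closure_subset Ay; apply: smallest_sub => //.
  by move=> z [->|[]].
by move=> /= y0; apply: K0; rewrite -y0.
Qed.

Lemma disjoint_halfspace (v : Y -> R^o) (beta : R) :
    dual_space v -> 0 < beta ->
    closure (conv_base psi (oppset K)) =
      [set x | closure (unit_ball psi) x /\ beta <= v x] ->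
    [\/ compact (base_of psi A),
        closed (conv_base0 psi A),
        closed A /\ compact (closure (base_of psi A)) |
        closed A /\
        closed (conv_hull (closure (base_of psi A) `|` [set 0]))] ->
  closure (conv_base0 psi A) `&` closure (conv_base psi (oppset K)) = set0.
Proof.
move=> [lv cv] beta0 KE cases.
have clBA : closure (base_of psi A) `<=` closure (unit_ball psi).
  by apply: closure_subset => y [_ py]; rewrite /unit_ball/= py.
have vA y : A y -> closure (base_of psi A) y -> v y < beta.
  move=> Ay By; rewrite ltNge; apply/negP => vy.
  have : [set 0] y.
    rewrite -KA; split=> //; apply: closure_conv_base_opp.
    by rewrite KE; split=> //; exact: clBA.
  by move=> /= y0; move: vy; rewrite y0 (linear_fun0 lv); lra.
have BA : base_of psi A `<=` closure (base_of psi A) by exact: subset_closure.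
suff vS : forall y, closure (conv_base0 psi A) y -> v y < beta.
  apply/seteqP; split=> // y [/vS vy]; rewrite KE => -[_]; lra.
(* Treats both compact cases: [G] is [B_A] itself, or its closure when [A] is closed. Compactness
   supplies a bound [m < beta] that survives hull and closure. *)
have from_compact G : base_of psi A `<=` G -> G `<=` A ->
    G `<=` closure (base_of psi A) -> compact G ->
    forall y, closure (conv_base0 psi A) y -> v y < beta.
  move=> BG GA GB cG.
  have [m mb vm] := compact_lt_le cv cG (fun x Gx => vA x (GA x Gx) (GB x Gx)).
  (* The level must also accommodate the added point 0, hence the maximum with 0; it stays below
     [beta] because [beta > 0]. *)
  have clm : closed [set y | v y <= Num.max 0 m].
    apply: (@closed_comp _ _ v [set r : R^o | r <= Num.max 0 m]) => [x _|].
      exact: cv.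
    exact: closed_le.
  move=> y; have /closure_subset/[apply] :
      conv_base0 psi A `<=` [set y | v y <= Num.max 0 m].
    apply: smallest_sub; first exact: convex_le.
    move=> z [->|Bz] /=; rewrite le_max; first by rewrite (linear_fun0 lv) lexx.
    by rewrite vm ?orbT//; exact: BG.
  rewrite -(closure_id _).1// => /le_lt_trans; apply.
  by rewrite gt_max beta0.
(* When the hull is already closed, the strict inequality only has to pass to convex combinations,
   so no uniform margin is required. *)
have hull_lt G : (forall y, G y -> v y < beta) ->
    forall y, conv_hull G y -> v y < beta.
  move=> vG; apply: (@smallest_sub _ _ _ [set y | v y < beta]) => //.
  exact: convex_lt.
have [cB|clS|[clA cB]|[clA clS]] := cases.
- by apply: (from_compact _ _ _ _ cB) => // y [].
- rewrite -(closure_id _).1//; apply: hull_lt => z.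
  move=> [->|Bz] /=; first by rewrite (linear_fun0 lv).
  by apply: vA; [exact: Bz.1|exact: BA].
- apply: (from_compact _ _ _ _ cB) => //.
  by rewrite [X in _ `<=` X](closure_id _).1//; apply: closure_subset => y [].
- move=> y Sy; have : conv_hull (closure (base_of psi A) `|` [set 0]) y.
    rewrite [X in X y](closure_id _).1//; apply: closure_subset Sy.
    apply: smallest_sub; first exact: convex_conv_hull.
    move=> z [->|Bz] C [_]; apply; first by right.
    by left; exact: BA.
  apply: hull_lt => z [Bz|->]; last by rewrite (linear_fun0 lv).
  apply: vA => //; rewrite [A](closure_id _).1//.
  by apply: closure_subset Bz => x [].
Qed.

Lemma separating_functional :
    normlike_base psi K -> normlike_base psi A ->
    compact (closure (conv_base psi (oppset K))) \/
      compact (closure (conv_base0 psi A)) ->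
    closure (conv_base0 psi A) `&` closure (conv_base psi (oppset K)) = set0 ->
  exists (u : Y -> R^o) (alpha : R), [/\ aug_dual psi K (u, alpha), 0 < alpha &
    forall y, A y -> y != 0 -> - alpha * psi y < u y].
Proof.
move=> nK nA cpt disj.
have [k0 Kk0] := normlike_base_neq0 nK.
have Sk0 : conv_base psi (oppset K) (- k0).
  by move=> C [_]; apply; apply/base_of_opp; rewrite opprK.
have S0 : conv_base0 psi A 0 by move=> C [_]; apply; left.
have [||||||u du uS] := @strict_separation _ _ (conv_base0 psi A)
    (conv_base psi (oppset K)).
- exact: convex_conv_hull.
- exact: convex_conv_hull.
- by exists 0.
- by exists (- k0).
- by case: cpt; [right|left].
- exact: disj.
have [lu _] := du.
pose U := u @` conv_base psi (oppset K).
have supU : has_sup U.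
  split; first by exists (u (- k0)), (- k0).
  by exists (u 0) => _ [y Sy <-]; have := uS _ _ S0 Sy; lra.
have leU y : conv_base psi (oppset K) y -> u y <= sup U.
  by move=> Sy; apply: ub_le_sup; [exact: supU.2|exists y].
have geU x : conv_base0 psi A x -> sup U + 1 <= u x.
  move=> Sx; rewrite -lerBrDr; apply: ge_sup; first exact: supU.1.
  by move=> _ [y Sy <-]; rewrite lerBrDr; exact: uS.
have supU_lt0 : sup U + 1 <= 0 by rewrite -(linear_fun0 lu); exact: geU.
(* The value [- alpha = sup U + 1 / 2] is the middle of the gap: [u <= sup U] on [S_{-K}] and
   [u >= sup U + 1] on [S^0_A]. As 0 lies in the latter, [sup U <= - 1] and [alpha >= 1 / 2]. Both
   inequalities are then rescaled from [(psi y)^-1 *: y] to [y]. *)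
exists u, (- sup U - 1 / 2); split; last 2 first.
- lra.
- move=> y Ay y0; have py : 0 < psi y by case: nA => _ _; apply.
  have : conv_base0 psi A ((psi y)^-1 *: y).
    by move=> C [_]; apply; right; exact: normlike_base_scale.
  move=> /geU; rewrite (linear_funZ lu) ler_pdivlMl// => h.
  by apply: lt_le_trans h; rewrite mulrC ltr_pM2l//; lra.
split=> //=; first by lra.
move=> y [Ky /eqP y0]; have py : 0 < psi y by case: nK => _ _; apply.
have : conv_base psi (oppset K) (- ((psi y)^-1 *: y)).
  move=> C [_]; apply; apply/base_of_opp; rewrite opprK.
  exact: normlike_base_scale.
move=> /leU; rewrite (linear_funN lu) (linear_funZ lu) lerNl ler_pdivlMl// => h.
by rewrite subr_gt0; apply: lt_le_trans h; rewrite mulrC ltr_pM2l//; lra.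
Qed.

End Bases.
Unset Implicit Arguments.

(** * The cone at [xbar] and the scalarization properties *)

Theorem corollary32 (R : realType) (X : topologicalLmodType R) (Y : tvsType R)
    (Omega : set X) (f : X -> Y) (AA : X -> set Y) (psi : Y -> R)
    (K : set Y) (xbar : X)
    (Omega_neq0 : Omega !=set0)
    (AA_cone : forall x, Omega x -> is_cone (AA x))
    (psi_seminorm : is_seminorm psi)
    (K_cone : is_cone K) (K_nontrivial : nontrivial K)
    (K_closed : closed K) (K_convex : convex_set K)
    (K_base0 : ~ closure (conv_base psi (oppset K)) 0)
    (xbar_PEff : PEff Omega f AA K xbar)
    (A := AA xbar) (A_cone : is_cone A)
    (image_neq0 : [set 0] <> addset (f @` Omega) [set - f xbar])
    (image_sub : addset (f @` Omega) [set - f xbar] `<=` A)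
    (K_base : normlike_base psi K) (A_base : normlike_base psi A)
    (one_compact : compact (closure (conv_base psi (oppset K))) \/
                   compact (closure (conv_base0 psi A)))
    (ab : (closed A /\ convex_set A) \/
      ((exists (v : Y -> R^o) (beta : R), [/\ dual_space v, 0 < beta &
          closure (conv_base psi (oppset K)) =
          [set x | closure (unit_ball psi) x /\ beta <= v x]]) /\
       [\/ compact (base_of psi A),
           closed (conv_base0 psi A),
           closed A /\ compact (closure (base_of psi A)) |
           closed A /\
           closed (conv_hull (closure (base_of psi A) `|` [set 0]))])) :
  exists (u : Y -> R^o) (alpha : R),
    let C := bp_cone psi u alpha in
    [/\ aug_dual psi K (u, alpha), 0 < alpha, Eff Omega f C xbar &
      C <> linspace C ->
      forall phi : Y -> R,
        sublinear phi -> phi 0 = 0 -> represents_opp phi C ->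
      [/\ (* (i) *)
          forall k, (C `\` linspace C) k ->
            [set p | Omega p.1 /\ f p.1 = f xbar /\ p.2 = 0] =
            P_solutions Omega f phi (f xbar) k,
          (* (ii) *)
          [set x | Omega x /\ f x = f xbar] =
          argmin Omega (fun x => phi (f x - f xbar)),
          (* (iii) *)
          forall (P T : set Y) (S : set R),
            T `<=` C `\` linspace C ->
            f @` Eff Omega f C `<=` addset P (scaleset S T) ->
            exists (a k : Y) (s : R), [/\ P a, T k, S s &
              [set p | Omega p.1 /\ f p.1 = f xbar /\ p.2 = s] =
              P_solutions Omega f phi a k] &
          (* (iv) *)
          forall (P T : set Y) (S : set R),
            T `<=` C `\` linspace C ->
            f @` Eff Omega f C `<=` addset P (scaleset S T) ->
            closed C ->
            exists (a k : Y) (s : R), [/\ P a, T k, S s &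
              let E := addset [set a] (oppset C) in
              gerstewitz E k (f xbar) = s%:E /\
              [set x | Omega x /\ f x = f xbar] =
              argmin Omega (fun x => gerstewitz E k (f x))]]].
Proof.
have Oxb := xbar_PEff.1.1.
have disj : closure (conv_base0 psi A) `&` closure (conv_base psi (oppset K)) = set0.
  have [[clA cA]|[[v [beta [dv beta0 KE]]] cases]] := ab.
    exact: (disjoint_closed_convex K_closed K_convex xbar_PEff.2 A_cone.1).
  exact: (disjoint_halfspace K_closed K_convex xbar_PEff.2 dv beta0 KE).
have [u [alpha [uK alpha0 uA]]] :=
  separating_functional psi_seminorm K_base A_base one_compact disj.
have lu : linear u by case: uK => -[].
exists u, alpha => C.
have C0 : C 0 := bp_cone0 psi_seminorm alpha lu.
have CD := bp_coneD psi_seminorm lu (ltW alpha0).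
have CZ := bp_coneZ psi_seminorm (u := u) (alpha := alpha) lu.
have EffC : Eff Omega f C xbar.
  split=> // -[x Ox [_ -> [w /oppsetE[Cw /eqP w0] fx]]].
  rewrite oppr_eq0 in w0.
  (* Here [w = f x - f xbar] lies in [A], so [u w > - alpha * psi w], whereas [- w] in [C] gives the
     opposite inequality. *)
  have /uA/(_ w0) : A w.
    apply: image_sub; exists (f x); first exact: imageP.
    by exists (- f xbar) => //; rewrite -fx addrAC subrr add0r.
  by move: Cw; rewrite /C/bp_cone/= seminormN// (linear_funN lu); lra.
split=> // _ phi phi_sublin phi0 phiC.
have phiE y : phi y <= 0 <-> C (- y).
  by rewrite -oppsetE phiC.
(* As [xbar] is efficient for [C], the covering assumption decomposes [f xbar] itself; (iii) and
   (iv) use this [a], [k] and [s]. *)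
have reprP P T (S : set R) : f @` Eff Omega f C `<=` addset P (scaleset S T) ->
    exists a k s, [/\ P a, T k, S s & f xbar = a + s *: k].
  move=> fP; have [a Pa [_ [s Ss [k Tk <-]] aE]] := fP _ (imageP f EffC).
  by exists a, k, s.
split=> [k kC||P T S TC fP|P T S TC fP _].
- by apply: (Eff_P_solutions C0 CD CZ EffC kC) => //; rewrite scale0r addr0.
(* By efficiency, [phi (f z - f xbar) <= 0] only if [f z = f xbar], where the value is 0; so the
   minimum is 0. *)
- apply/seteqP; split=> [x /= [Ox fx]|x [Ox minx]].
    split=> // z Oz; rewrite fx subrr phi0 leNgt; apply/negP => phiz.
    have /phiE := ltW phiz; rewrite opprB => /(Eff_eq EffC Oz) fz.
    by move: phiz; rewrite fz subrr phi0 ltxx.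
  split=> //; apply: (Eff_eq EffC Ox); rewrite -opprB; apply/phiE.
  by have := minx _ Oxb; rewrite subrr phi0.
- have [a [k [s [Pa Tk Ss aE]]]] := reprP _ _ _ fP.
  exists a, k, s; split=> //.
  exact: (Eff_P_solutions C0 CD CZ EffC (TC _ Tk) aE).
- have [a [k [s [Pa Tk Ss aE]]]] := reprP _ _ _ fP.
  exists a, k, s; split=> //.
  apply: (Eff_gerstewitz C0 CD CZ EffC (TC _ Tk) aE) => y.
  exact: (bp_cone_ray_closed psi_seminorm lu (ltW alpha0)).
Qed.
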